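(* Let $s\ge 3$ be an odd integer and let $K$ be the quaternary Kerdock code of length $2^s$ over $\mathbb{Z}_4$. Then the binary Kerdock code, i.e. the Gray image of $K$ in $\mathbb{F}_2^{2^{s+1}}$, is not linear.
   Context: $K=\mathbb{Z}_4\mathbf{j}\oplus Q\subseteq\mathbb{Z}_4^{2^s}$, where $\mathbf{j}$ is the all-one vector and $Q=\{(\mathrm{Tr}(ax))_{x\in\mathcal{T}}: a\in\mathrm{GR}(4,s)\}$. Here $\mathrm{GR}(4,s)$ is the Galois ring of characteristic $4$ with $4^s$ elements, $\mathcal{T}=\{0,1,\xi,\dots,\xi^{2^s-2}\}$ is its Teichmüller set ($\xi$ an element of multiplicative order $2^s-1$), and $\mathrm{Tr}:\mathrm{GR}(4,s)\to\mathbb{Z}_4$ is the trace map. The Gray map is $0\mapsto 00$, $1\mapsto 01$, $2\mapsto 11$, $3\mapsto 10$, applied coordinatewise. *)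

(* Defs.v *)
From HB Require Import structures.
From mathcomp Require Import all_boot all_order all_algebra.

Set Implicit Arguments.
Unset Strict Implicit.
Unset Printing Implicit Defensive.

Import GRing.Theory.
Local Open Scope ring_scope.

(* Galois ring of characteristic 4 with 4 ^ s elements: a finite commutative
   ring whose zero divisors (0 included) form the ideal generated by 2.  These
   axioms determine GR(4, s) up to isomorphism. *)
Record galois_ring4 (s : nat) (R : finComNzRingType) : Prop := GaloisRing4 {
  galois_ring4_char : forall n : nat, ((n%:R : R) == 0) = (4 %| n)%N;
  galois_ring4_card : #|R| = (4 ^ s)%N;
  galois_ring4_zdiv : forall x : R,
    (exists2 y : R, y != 0 & x * y = 0) <-> (exists z : R, x = 2%:R * z)
}.

Section Kerdock.

Variables (s : nat) (R : finComNzRingType) (xi : R).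

(* The list 0, 1, xi, ..., xi ^ (2 ^ s - 2); it fixes the order of the code
   coordinates. *)
Definition teich (i : 'I_(2 ^ s)) : R :=
  if val i is k.+1 then xi ^+ k else 0.

Definition teichmuller : {set R} := [set teich i | i : 'I_(2 ^ s)].

(* a + 2 b |-> a ^ 2 + 2 b ^ 2 for a, b in the Teichmuller set.  When
   R = GR(4, s) and xi has order 2 ^ s - 1, each c has exactly one such
   decomposition, so the default value is never taken. *)
Definition frobenius (c : R) : R :=
  if [pick p : R * R | [&& p.1 \in teichmuller, p.2 \in teichmuller
                         & c == p.1 + 2%:R * p.2]] is Some p
  then p.1 ^+ 2 + 2%:R * p.2 ^+ 2 else 0.

Definition traceR (c : R) : R := \sum_(j < s) iter j frobenius c.

(* traceR takes its values in the prime subring of R; trace reads them in 'Z_4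
   through the embedding t |-> t%:R. *)
Definition trace (c : R) : 'Z_4 :=
  odflt 0 [pick t : 'Z_4 | (t : nat)%:R == traceR c].

Definition codeQ : {set 'rV['Z_4]_(2 ^ s)} :=
  [set \row_(i < 2 ^ s) trace (a * teich i) | a : R].

Definition kerdock4 : {set 'rV['Z_4]_(2 ^ s)} :=
  [set c *: const_mx 1 + q | c in [set: 'Z_4], q in codeQ].

End Kerdock.

Definition gray (x : 'Z_4) : 'rV['F_2]_2 :=
  \row_(j < 2)
    nth 0 (nth [::] [:: [:: 0; 0]; [:: 0; 1]; [:: 1; 1]; [:: 1; 0]] x) j.

(* mxvec concatenates the rows gray (v 0 0), gray (v 0 1), ... *)
Definition gray_map (n : nat) (v : 'rV['Z_4]_n) : 'rV['F_2]_(n * 2) :=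
  mxvec (\matrix_(i < n) gray (v 0 i)).

Definition binary_kerdock (s : nat) (R : finComNzRingType) (xi : R) :
    {set 'rV['F_2]_(2 ^ s * 2)} :=
  [set gray_map v | v in kerdock4 s xi].

Definition linear_code (F : finFieldType) (n : nat) (C : {set 'rV[F]_n}) : Prop :=
  GRing.submod_closed C.

(* Main.v *)
Require Import Defs.
From HB Require Import structures.
From mathcomp Require Import all_boot all_order all_algebra.
From mathcomp Require Import ring zify.

Set Implicit Arguments.
Unset Strict Implicit.
Unset Printing Implicit Defensive.

Import GRing.Theory.
Local Open Scope ring_scope.

(** The Gray map satisfies [gray u + gray v = gray (u + v + 2 u v)], so if the
    binary code were linear, the quaternary code would contain
    [u + v + 2 (u * v)] for any two of its words [u] and [v].  For
    [u = (Tr x)] and [v = (Tr (xi x))], with [x] in the Teichmuller set [T],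
    this gives [c] and [a] with
      [c + Tr (a x) = Tr x + Tr (xi x) + 2 Tr x Tr (xi x)]  for all [x].

    Both sides are now read in the Galois ring, as polynomial functions of
    [x = xi ^ k].  With [n = 2 ^ s - 1], multiplying by [x ^ (n - 3) = x ^ (-3)]
    and summing over [k < n] yields [n] times the coefficient of [x ^ 3], because
    the power sums of [xi] vanish at every exponent not divisible by [n]
    ([power_sum]).  The functions [Tr (b x)] only involve the exponents
    [2 ^ j], and never [3] ([cubic_coef_traceR]); in the product the exponents
    are [2 ^ i + 2 ^ j <= 2 ^ s], and [3] arises only as [1 + 2] and [2 + 1]
    ([cubic_coef_traceR_mul]).  Comparing both sides leaves
    [2 (xi + xi ^ 2) = 0], hence [xi = - 1 + 2 z] and [xi ^ 2 = 1], whereas the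
    order of [xi] is at least 7 ([traceR_product_formula_false]).

    Passing from the equation over Z_4 to the ring requires the trace to take
    values in the prime subring ([trace_natr]).  This holds because the
    generalized Frobenius map is additive ([frobeniusD]), hence fixes the
    trace, and fixes only 0, 1, 2 and 3 ([frobenius_fixed]). *)

(** * Sums of two powers of two *)

Lemma exp2_neq3 j : (2 ^ j == 3)%N = false.
Proof. by case: j => [|j] //; rewrite expnS; lia. Qed.

Lemma exp2D_eq3 i j :
  (2 ^ i + 2 ^ j == 3)%N = (i == 0%N) && (j == 1%N) || (i == 1%N) && (j == 0%N).
Proof.
have p k : (2 ^ k.+2 = 4 * 2 ^ k)%N by rewrite !expnS; lia.
by case: i => [|[|i]]; case: j => [|[|j]] //; rewrite ?p /=; lia.
Qed.

(** * Squaring modulo 4 *)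

Section GaloisRing.

Variables (s : nat) (R : finComNzRingType) (xi : R).
Hypothesis s_gt1 : (1 < s)%N.
Hypothesis R_galois : galois_ring4 s R.
Hypothesis xi_order : (2 ^ s - 1)%N.-primitive_root xi.

Local Notation q := (2 ^ s)%N.
Local Notation n := (2 ^ s - 1)%N.
Local Notation T := (teichmuller s xi).
Local Notation F := (frobenius s xi).

Lemma four_eq0 : 4%:R = 0 :> R.
Proof. by apply/eqP; rewrite (galois_ring4_char R_galois). Qed.

Lemma two_neq0 : 2%:R != 0 :> R.
Proof. by rewrite (galois_ring4_char R_galois). Qed.

Lemma zero_divisor (x y : R) : x * y = 0 -> y != 0 -> exists z, x = 2%:R * z.
Proof. by move=> xy0 y0; apply/(galois_ring4_zdiv R_galois); exists y. Qed.

Lemma two_mul_eq0 (x : R) : 2%:R * x = 0 -> exists z, x = 2%:R * z.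
Proof. by rewrite mulrC => /zero_divisor; apply; exact: two_neq0. Qed.

Lemma two_mul_inj (x y : R) : 2%:R * x = 2%:R * y -> exists z, x = y + 2%:R * z.
Proof.
move=> exy; have [|z ez] := @two_mul_eq0 (x - y); first by rewrite mulrBr exy subrr.
by exists z; rewrite -ez addrC subrK.
Qed.

(** Squares, hence all powers of exponent [2 ^ k] with [k > 0], depend only on
    the residue modulo 2: this replaces every computation in the residue field. *)
Lemma sqr_add_two_mul (x y : R) : (x + 2%:R * y) ^+ 2 = x ^+ 2.
Proof.
transitivity (x ^+ 2 + 4%:R * (x * y + y ^+ 2)); first by ring.
by rewrite four_eq0 mul0r addr0.
Qed.

Lemma exp2_add_two_mul k (x y : R) :
  (0 < k)%N -> (x + 2%:R * y) ^+ (2 ^ k) = x ^+ (2 ^ k).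
Proof. by case: k => // k _; rewrite expnS !exprM sqr_add_two_mul. Qed.

(** Among the inner binomial coefficients of exponent [2 ^ k.+1], only the middle
    one is nonzero modulo 4, and it is 2 modulo 4. *)
Lemma exp2_add k (x y : R) :
  (x + y) ^+ (2 ^ k.+1) =
    x ^+ (2 ^ k.+1) + y ^+ (2 ^ k.+1) + 2%:R * (x * y) ^+ (2 ^ k).
Proof.
elim: k => [|k IHk]; first by rewrite expn1 expn0 expr1; ring.
rewrite expnSr exprM IHk sqr_add_two_mul [(2 ^ k.+1)%N in RHS]expnSr !exprM !exprMn.
rewrite (expnSr 2 k) !exprM. by ring.
Qed.

Lemma two_mul_sqr (x y : R) :
  2%:R * x = 2%:R * y -> 2%:R * x ^+ 2 = 2%:R * y ^+ 2.
Proof. by move/two_mul_inj=> [z ->]; rewrite sqr_add_two_mul. Qed.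

(** The ring is local: a non-unit is a multiple of 2 and so has square 0. *)
Lemma idempotent_01 (e : R) : e ^+ 2 = e -> e = 0 \/ e = 1.
Proof.
move=> ee; have [|e1] := eqVneq (1 - e) 0.
  by move/eqP; rewrite subr_eq0 => /eqP; right.
have [|z ez] := zero_divisor (x := e) _ e1; first by rewrite mulrBr mulr1 -expr2 ee subrr.
by left; rewrite -ee ez -[_ * z]add0r sqr_add_two_mul expr0n.
Qed.

(** Multiplication by 2 identifies the residue field with the ideal of multiples
    of 2, so this says that the idempotents of that field are 0 and 1. *)
Lemma idempotent_mod2 (x : R) :
  2%:R * x ^+ 2 = 2%:R * x -> 2%:R * x = 0 \/ 2%:R * x = 2%:R.
Proof.
move=> exx; have [|e1] := eqVneq (2%:R * (1 - x)) 0.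
  by move/eqP; rewrite mulrBr mulr1 subr_eq0 => /eqP; right.
have [|z ->] := zero_divisor (x := x) _ e1.
  by rewrite mulrCA mulrBr mulr1 mulrBr -expr2 exx subrr.
by left; rewrite mulrA -natrM four_eq0 mul0r.
Qed.

(** * Teichmuller decomposition *)

Lemma card_units_gt0 : (0 < n)%N.
Proof. by rewrite subn_gt0 -{1}(expn0 2) ltn_exp2l //; lia. Qed.

Lemma teichmullerP (x : R) : reflect (x = 0 \/ exists k, x = xi ^+ k) (x \in T).
Proof.
have q_gt0 : (0 < q)%N by rewrite expn_gt0.
apply: (iffP imsetP) => [[[[|k] ltk] _ ->]|[->|[k ->]]].
- by left.
- by right; exists k.
- by exists (Ordinal q_gt0).
have lt_kq : ((k %% n).+1 < q)%N.
  by have := ltn_pmod k card_units_gt0; lia.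
by exists (Ordinal lt_kq); rewrite // /teich /= (prim_expr_mod xi_order).
Qed.

Lemma teichmullerM (x y : R) : x \in T -> y \in T -> x * y \in T.
Proof.
move=> /teichmullerP[-> _|[k ->]]; first by rewrite mul0r; apply/teichmullerP; left.
case/teichmullerP=> [->|[l ->]]; first by rewrite mulr0; apply/teichmullerP; left.
by apply/teichmullerP; right; exists (k + l)%N; rewrite exprD.
Qed.

Lemma teichmuller_exp (x : R) k : x \in T -> x ^+ k \in T.
Proof.
move=> xT; elim: k => [|k IHk]; last by rewrite exprS teichmullerM.
by apply/teichmullerP; right; exists 0%N; rewrite !expr0.
Qed.

Lemma teichmuller_fixed (x : R) : x \in T -> x ^+ q = x.
Proof.
have eq_q : q = n.+1 by have := card_units_gt0; lia.
case/teichmullerP=> [->|[k ->]]; first by rewrite eq_q expr0n.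
by rewrite -exprM mulnC exprM {1}eq_q exprS (prim_expr_order xi_order) mulr1.
Qed.

(** The power [2 ^ s] fixes [T] and kills the term [2 b], so it extracts [a]; then
    [b] is determined modulo 2, and the same power recovers it. *)
Lemma teich_decomp_inj (a b a' b' : R) :
  a \in T -> b \in T -> a' \in T -> b' \in T ->
  a + 2%:R * b = a' + 2%:R * b' -> a = a' /\ b = b'.
Proof.
move=> aT bT a'T b'T eab.
have s_gt0 : (0 < s)%N by lia.
have ea : a = a'.
  rewrite -(teichmuller_fixed aT) -(teichmuller_fixed a'T).
  by rewrite -(exp2_add_two_mul a b) // eab exp2_add_two_mul.
split=> //; move: eab; rewrite ea => /addrI /two_mul_inj[z eb].
by rewrite -(teichmuller_fixed bT) eb exp2_add_two_mul // teichmuller_fixed.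
Qed.

Lemma xi_exp_neq0 k : xi ^+ k != 0.
Proof.
apply/eqP=> xik0; have := prim_expr_order xi_order.
move/(congr1 (fun x => x ^+ k)); rewrite expr1n -exprM mulnC exprM xik0.
rewrite expr0n eqn0Ngt card_units_gt0 => /eqP.
by rewrite eq_sym oner_eq0.
Qed.

Lemma card_teichmuller : #|T| = q.
Proof.
rewrite card_imset ?card_ord // => -[[|i] lti] [[|j] ltj]; rewrite /teich /=.
- by move=> _; apply: val_inj.
- by move/esym/eqP; rewrite (negbTE (xi_exp_neq0 _)).
- by move/eqP; rewrite (negbTE (xi_exp_neq0 _)).
move/eqP; rewrite (eq_prim_root_expr xi_order) !modn_small; try lia.
by move/eqP=> eij; apply: val_inj; rewrite /= eij.
Qed.

(** Since the decomposition is unique and [T] has [2 ^ s] elements, the [4 ^ s]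
    sums fill the ring. *)
Lemma teich_decomp (c : R) :
  exists a b, [/\ a \in T, b \in T & c = a + 2%:R * b].
Proof.
pose f (p : R * R) := p.1 + 2%:R * p.2.
have f_inj : {in setX T T &, injective f}.
  move=> [a b] [a' b']; rewrite !inE /= => /andP[aT bT] /andP[a'T b'T].
  by case/(teich_decomp_inj aT bT a'T b'T) => -> ->.
have : c \in f @: setX T T.
  suff -> : f @: setX T T = setT by rewrite inE.
  apply/eqP; rewrite eqEcard subsetT cardsT (galois_ring4_card R_galois).
  by rewrite card_in_imset // cardsX card_teichmuller -expnMn leqnn.
case/imsetP=> -[a b]; rewrite !inE /= => /andP[aT bT] ->.
by exists a, b.
Qed.

(** * Frobenius map and trace *)

Lemma frobeniusE (a b : R) :
  a \in T -> b \in T -> F (a + 2%:R * b) = a ^+ 2 + 2%:R * b ^+ 2.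
Proof.
move=> aT bT; rewrite /frobenius; case: pickP => [[a' b'] /=|/(_ (a, b))].
  by case/and3P=> a'T b'T /eqP/teich_decomp_inj[] // -> ->.
by rewrite /= aT bT eqxx.
Qed.

(** An expression for the Frobenius map that involves only ring operations and
    the choice of any half [b] of [c - c ^ q], from which additivity can be computed. *)
Lemma frobenius_sqr (c b : R) :
  2%:R * b = c - c ^+ q -> F c = c ^+ 2 + 2%:R * b ^+ 2.
Proof.
have [a [b' [aT b'T ->]]] := teich_decomp c.
rewrite exp2_add_two_mul; last by lia.
rewrite teichmuller_fixed // addrC addKr => /two_mul_sqr ->.
by rewrite frobeniusE // sqr_add_two_mul.
Qed.

Lemma teich_defect (c : R) : exists b, 2%:R * b = c - c ^+ q.
Proof.
have [a [b [aT bT ->]]] := teich_decomp c; exists b.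
by rewrite exp2_add_two_mul ?teichmuller_fixed //; [rewrite addrC addKr | lia].
Qed.

(** The exponent [q = 2 ^ s] fails to be additive by [2 (c d) ^ (q / 2)], and
    squaring fails by [2 c d]; as [(c d) ^ q] is [c d] modulo 2, the two errors
    cancel modulo 4. *)
Lemma frobeniusD (c d : R) : F (c + d) = F c + F d.
Proof.
have [[b eb] [b' eb']] := (teich_defect c, teich_defect d).
have es : s = s.-1.+1 by lia.
have two_exp (x : R) : 2%:R * x ^+ q = 2%:R * x.
  have [y ey] := teich_defect x.
  apply/eqP; rewrite eq_sym -subr_eq0 -mulrBr -ey mulrA -natrM four_eq0.
  by rewrite mul0r.
pose h := b + b' + (c * d) ^+ (2 ^ s.-1).
have eh : 2%:R * h = (c + d) - (c + d) ^+ q.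
  rewrite {1}es exp2_add -es /h !mulrDr eb eb'.
  (* The two sides differ by 4 (c d) ^ (q / 2). *)
  rewrite -[LHS]addr0 -[X in _ + X = _](mul0r ((c * d) ^+ (2 ^ s.-1))) -oppr0.
  by rewrite -four_eq0; ring.
rewrite (frobenius_sqr eb) (frobenius_sqr eb') (frobenius_sqr eh) /h.
have eX : 2%:R * ((c * d) ^+ (2 ^ s.-1)) ^+ 2 = 2%:R * (c * d).
  by rewrite -exprM -expnSr -es two_exp.
transitivity (c ^+ 2 + 2%:R * b ^+ 2 + (d ^+ 2 + 2%:R * b' ^+ 2)
   + (2%:R * (c * d) + 2%:R * ((c * d) ^+ (2 ^ s.-1)) ^+ 2)
   + 4%:R * (b * b' + (b + b') * (c * d) ^+ (2 ^ s.-1))); first by ring.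
rewrite eX -mulrDl -natrD four_eq0 !mul0r !addr0. by [].
Qed.

Lemma frobenius0 : F 0 = 0.
Proof. by apply: (@addrI _ (F 0)); rewrite -frobeniusD !addr0. Qed.

Lemma iter_frobenius (a b : R) j : a \in T -> b \in T ->
  iter j F (a + 2%:R * b) = a ^+ (2 ^ j) + 2%:R * b ^+ (2 ^ j).
Proof.
move=> aT bT; elim: j => [|j IHj]; first by rewrite expn0 !expr1.
by rewrite iterS IHj frobeniusE ?teichmuller_exp // -!exprM -expnSr.
Qed.

Lemma traceRE (a b : R) : a \in T -> b \in T ->
  traceR s xi (a + 2%:R * b) = \sum_(j < s) (a ^+ (2 ^ j) + 2%:R * b ^+ (2 ^ j)).
Proof. by move=> aT bT; apply: eq_bigr => j _; rewrite iter_frobenius. Qed.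

(** Additivity makes the Frobenius map permute cyclically the terms of the trace. *)
Lemma frobenius_traceR (c : R) : F (traceR s xi c) = traceR s xi c.
Proof.
have shift (g : R -> R) m : iter m g c = c ->
    \sum_(j < m) g (iter j g c) = \sum_(j < m) iter j g c.
  case: m => [|m] gm; first by rewrite !big_ord0.
  by rewrite big_ord_recr big_ord_recl /= addrC; congr (_ + _); exact: gm.
have Fs : iter s F c = c.
  have [a [b [aT bT ->]]] := teich_decomp c.
  by rewrite iter_frobenius // !teichmuller_fixed.
by rewrite /traceR (big_morph F frobeniusD frobenius0) shift.
Qed.

(** If [t] is fixed then [t ^ 2] is idempotent and equal to [t ^ q], so
    [t = t ^ 2 + 2 w] where [t ^ 2] is 0 or 1; being fixed then makes [w] idempotent
    modulo 2. *)
Lemma frobenius_fixed (t : R) : F t = t -> exists k : 'Z_4, t = (k : nat)%:R.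
Proof.
have [w ew] := teich_defect t; rewrite (frobenius_sqr ew) => Ft.
have t4 : (t ^+ 2) ^+ 2 = t ^+ 2 by rewrite -{2}Ft sqr_add_two_mul.
have et : t = t ^+ 2 + 2%:R * w.
  rewrite ew; have -> : t ^+ q = t ^+ 2; last by ring.
  have -> : s = s.-1.+1 by lia.
  elim: s.-1 => [|k IHk]; first by rewrite expn1.
  by rewrite expnSr exprM IHk.
have ww : 2%:R * w ^+ 2 = 2%:R * w by apply: (@addrI _ (t ^+ 2)); rewrite Ft -et.
rewrite et; case: (idempotent_01 t4) => ->; case: (idempotent_mod2 ww) => ->.
- by exists 0; rewrite addr0.
- by exists (inZp 2); rewrite add0r.
- by exists 1; rewrite addr0.
- by exists (inZp 3); rewrite addrC natr1.
Qed.

Lemma trace_natr (c : R) : (trace s xi c : nat)%:R = traceR s xi c.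
Proof.
rewrite /trace; case: pickP => [t /eqP //|no_t].
have [k ek] := frobenius_fixed (frobenius_traceR c).
by have := no_t k; rewrite -ek eqxx.
Qed.

(** * Embedding of Z_4 *)

Lemma natr_mod4 k : (k %% 4)%:R = k%:R :> R.
Proof. by rewrite [in RHS](divn_eq k 4) natrD natrM four_eq0 mulr0 add0r. Qed.

Lemma Z4_natrD (x y : 'Z_4) : ((x + y)%R : nat)%:R = x%:R + y%:R :> R.
Proof. by rewrite -natrD -[RHS]natr_mod4. Qed.

Lemma Z4_natrM (x y : 'Z_4) : ((x * y)%R : nat)%:R = x%:R * y%:R :> R.
Proof. by rewrite -natrM -[RHS]natr_mod4. Qed.

(** * Power sums and the cubic coefficient of the trace *)

Lemma odd_order : odd n.
Proof.
have : odd q = false by rewrite oddX; case: (s) s_gt1.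
by have := card_units_gt0; lia.
Qed.

(** The sum is annihilated by [1 - xi ^ m].  If it were nonzero, [xi ^ m] would be
    1 modulo 2, so [xi ^ (2 m) = 1] and the odd number [n] would divide [m]. *)
Lemma power_sum m :
  \sum_(k < n) (xi ^+ k) ^+ m = if (n %| m)%N then n%:R else 0.
Proof.
case: ifPn => [n_m|nm].
  rewrite (eq_bigr (fun=> 1)) ?sumr_const ?card_ord // => k _.
  apply/eqP; rewrite -exprM -(prim_order_dvd xi_order) dvdn_mull //.
have e0 : (\sum_(k < n) (xi ^+ k) ^+ m) * (1 - xi ^+ m) = 0.
  rewrite mulrC; under eq_bigr do rewrite exprAC.
  have /esym := subrX1 (xi ^+ m) n.
  rewrite exprAC (prim_expr_order xi_order) expr1n subrr => e.
  by rewrite -opprB mulNr e oppr0.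
apply/eqP; apply/negP => /negP nz0.
have [z ez] : exists z, 1 - xi ^+ m = 2%:R * z by apply: zero_divisor nz0; rewrite mulrC.
have : xi ^+ m = 1 + 2%:R * (- z) by rewrite mulrN -ez; ring.
move/(congr1 (fun x => x ^+ 2)); rewrite sqr_add_two_mul expr1n -exprM => /eqP.
rewrite -(prim_order_dvd xi_order) Gauss_dvdl ?(negbTE nm) //.
by rewrite coprimen2 odd_order.
Qed.

Lemma sum_exp2D_eq3 m (g : nat -> R) :
  \sum_(i < m.+2) \sum_(j < m.+2) (if (2 ^ i + 2 ^ j == 3)%N then g j else 0)
    = g 0%N + g 1%N.
Proof.
under eq_bigr do under eq_bigr do rewrite exp2D_eq3.
by rewrite !big_ord_recl /= !(big1 _ _ (fun=> 0)) // !add0r !addr0 addrC.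
Qed.

Hypothesis s_gt2 : (2 < s)%N.

Lemma order_ge7 : (7 <= n)%N.
Proof. by have : (2 ^ 3 <= q)%N; [rewrite leq_exp2l | lia]. Qed.

(** For [e <= q = n + 1] the exponent [n - 3 + e] lies strictly below [2 n], and
    above 0, so [n] is the only multiple of [n] it can equal. *)
Lemma cubic_power_sum e : (e <= q)%N ->
  \sum_(k < n) (xi ^+ k) ^+ (n - 3) * (xi ^+ k) ^+ e = if (e == 3)%N then n%:R else 0.
Proof.
move=> le_e; under eq_bigr do rewrite -exprD.
rewrite power_sum; congr (if _ then _ else _).
have n7 := order_ge7.
apply/idP/eqP => [/dvdnP[[|[|d]] ed]|->]; try lia.
by rewrite subnK //; lia.
Qed.

Lemma leq_exp2_pred j : (j < s)%N -> (2 * 2 ^ j <= q)%N.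
Proof. by move=> lt_js; rewrite -expnS leq_exp2l. Qed.

Lemma cubic_coef_traceR (a : R) :
  \sum_(k < n) (xi ^+ k) ^+ (n - 3) * traceR s xi (a * xi ^+ k) = 0.
Proof.
have [b [d [bT dT ->]]] := teich_decomp a.
transitivity (\sum_(k < n) \sum_(j < s) (b ^+ (2 ^ j) + 2%:R * d ^+ (2 ^ j)) *
    ((xi ^+ k) ^+ (n - 3) * (xi ^+ k) ^+ (2 ^ j))).
  apply: eq_bigr => k _; have xT : xi ^+ k \in T by apply/teichmullerP; right; exists k.
  rewrite mulrDl -mulrA traceRE ?teichmullerM // mulr_sumr.
  by apply: eq_bigr => j _; rewrite !exprMn; ring.
rewrite exchange_big big1 // => j _; rewrite -mulr_sumr cubic_power_sum.
  by rewrite exp2_neq3 mulr0.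
by have := leq_exp2_pred (ltn_ord j); lia.
Qed.

Lemma traceR_teichmuller (x : R) :
  x \in T -> traceR s xi x = \sum_(j < s) x ^+ (2 ^ j).
Proof.
move=> xT; have zT : 0 \in T by apply/teichmullerP; left.
have -> : traceR s xi x = traceR s xi (x + 2%:R * 0) by rewrite mulr0 addr0.
rewrite traceRE //; apply: eq_bigr => j _.
by rewrite expr0n expn_eq0 mulr0 addr0.
Qed.

Lemma cubic_coef_traceR_mul :
  \sum_(k < n) (xi ^+ k) ^+ (n - 3) *
      (traceR s xi (xi ^+ k) * traceR s xi (xi * xi ^+ k))
    = n%:R * (xi + xi ^+ 2).
Proof.
transitivity (\sum_(k < n) \sum_(i < s) \sum_(j < s) xi ^+ (2 ^ j) *
    ((xi ^+ k) ^+ (n - 3) * (xi ^+ k) ^+ (2 ^ i + 2 ^ j))).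
  apply: eq_bigr => k _; rewrite -exprS !traceR_teichmuller;
    try by apply/teichmullerP; right; eexists.
  rewrite mulr_suml mulr_sumr; apply: eq_bigr => i _.
  rewrite !mulr_sumr; apply: eq_bigr => j _.
  by rewrite exprS exprMn exprD; ring.
rewrite exchange_big /=; under eq_bigr do rewrite exchange_big /=.
transitivity (\sum_(i < s) \sum_(j < s)
    if (2 ^ i + 2 ^ j == 3)%N then n%:R * xi ^+ (2 ^ j) else 0).
  apply: eq_bigr => i _; apply: eq_bigr => j _.
  rewrite -mulr_sumr cubic_power_sum; first by case: ifP; rewrite ?mulr0 // mulrC.
  by have := (leq_exp2_pred (ltn_ord i), leq_exp2_pred (ltn_ord j)); case; lia.
have s2 : s.-2.+2 = s by lia.
have /= := sum_exp2D_eq3 s.-2 (fun j => n%:R * xi ^+ (2 ^ j)).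
by rewrite s2 => ->; rewrite expr1 mulrDr.
Qed.

Lemma two_mul_odd_natr k : odd k -> 2%:R * k%:R = 2%:R :> R.
Proof.
move=> odd_k; rewrite -natrM -natr_mod4 (_ : (2 * k) %% 4 = 2)%N //.
by rewrite -(odd_double_half k) odd_k; lia.
Qed.

Lemma traceR_product_formula_false (c a : R) :
  ~ (forall k : nat, c + traceR s xi (a * xi ^+ k) =
       traceR s xi (xi ^+ k) + traceR s xi (xi * xi ^+ k)
       + 2%:R * (traceR s xi (xi ^+ k) * traceR s xi (xi * xi ^+ k))).
Proof.
(* Up to the factor n, the functional that reads the coefficient of x ^ 3. *)
move=> tr_eq; pose L (f : nat -> R) := \sum_(k < n) (xi ^+ k) ^+ (n - 3) * f k.
have LD f g : L (fun k => f k + g k) = L f + L g.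
  by rewrite /L -big_split; apply: eq_bigr => k _; rewrite mulrDr.
have LZ b f : L (fun k => b * f k) = b * L f.
  by rewrite /L mulr_sumr; apply: eq_bigr => k _; rewrite mulrCA.
have Lcst : L (fun=> c) = 0.
  have := cubic_power_sum (leq0n q); under eq_bigr do rewrite expr0 mulr1.
  by rewrite /L -!mulr_suml => ->; rewrite mul0r.
(* The coefficient of x ^ 3 in both sides; n being odd, 2 n = 2. *)
have two_xi : 2%:R * (xi + xi ^+ 2) = 0.
  rewrite -(two_mul_odd_natr odd_order) -mulrA -cubic_coef_traceR_mul.
  have : L (fun k => c + traceR s xi (a * xi ^+ k)) =
      L (fun k => traceR s xi (xi ^+ k) + traceR s xi (xi * xi ^+ k)
       + 2%:R * (traceR s xi (xi ^+ k) * traceR s xi (xi * xi ^+ k))).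
    by apply: eq_bigr => k _; rewrite tr_eq.
  rewrite !LD LZ Lcst /L !cubic_coef_traceR.
  have := cubic_coef_traceR 1; under eq_bigr do rewrite mul1r.
  by move=> ->; rewrite !add0r.
have n_gt0 := card_units_gt0.
(* Cancel the unit xi. *)
have two_1xi : 2%:R * (1 + xi) = 0.
  transitivity (xi ^+ n.-1 * (2%:R * (xi + xi ^+ 2))); last by rewrite two_xi mulr0.
  have e1 : xi ^+ n.-1 * xi = 1 by rewrite -exprSr prednK // (prim_expr_order xi_order).
  transitivity (xi ^+ n.-1 * xi * (2%:R * (1 + xi))); first by rewrite e1 mul1r.
  by ring.
have [z ez] := two_mul_eq0 two_1xi.
have : xi ^+ 2 = 1.
  have -> : xi = -1 + 2%:R * z by rewrite -ez addKr.
  by rewrite sqr_add_two_mul sqrrN expr1n.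
move/eqP; rewrite -(prim_order_dvd xi_order) => /dvdn_leq.
by have := order_ge7; lia.
Qed.

End GaloisRing.

(** * Gray map and nonlinearity *)

Lemma gray_inj : injective gray.
Proof.
have : [forall x : 'Z_4, forall y : 'Z_4, (gray x == gray y) ==> (x == y)].
  apply/forallP=> x; apply/forallP=> y; apply/implyP=> /eqP/rowP exy.
  move: (exy 0) (exy 1); rewrite !mxE /=.
  by case: x exy => [[|[|[|[|x]]]] ltx]; case: y => [[|[|[|[|y]]]] lty].
by move/forallP=> inj x y exy; apply/eqP; have /forallP/(_ y)/implyP := inj x;
  apply; rewrite exy.
Qed.

Lemma grayD (x y : 'Z_4) : gray x + gray y = gray (x + y + 2%:R * (x * y)).
Proof.
apply/rowP=> j; rewrite !mxE.
case: x => [[|[|[|[|x]]]] ltx] //; case: y => [[|[|[|[|y]]]] lty] //;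
  by case: j => [[|[|j]] ltj] //; apply: val_inj.
Qed.

Theorem mainTheorem5 (s : nat) (R : finComNzRingType) (xi : R)
    (s_ge3 : (3 <= s)%N) (s_odd : odd s)
    (R_galois : galois_ring4 s R)
    (xi_order : (2 ^ s - 1)%N.-primitive_root xi) :
  ~ linear_code (binary_kerdock s xi).
Proof.
move=> linK; have s_gt1 : (1 < s)%N by lia.
pose w a : 'rV['Z_4]_(2 ^ s) := \row_i trace s xi (a * teich xi i).
have wK a : gray_map (w a) \in binary_kerdock s xi.
  apply: imset_f; apply/imset2P; exists 0 (w a); rewrite ?inE //.
    by apply/imsetP; exists a.
  by rewrite scale0r add0r.
have : gray_map (w 1) + gray_map (w xi) \in binary_kerdock s xi.
  by have := linK.2 1 _ _ (wK 1) (wK xi); rewrite scale1r.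
case/imsetP=> v /imset2P[c q _ /imsetP[a _ ->] ->] eK.
have coord (i : 'I_(2 ^ s)) : c + trace s xi (a * teich xi i) =
    trace s xi (teich xi i) + trace s xi (xi * teich xi i)
    + 2%:R * (trace s xi (teich xi i) * trace s xi (xi * teich xi i)).
  apply: gray_inj; rewrite -grayD.
  move/(congr1 (fun u : 'rV['F_2]_(2 ^ s * 2) => row i (vec_mx u))): eK.
  by rewrite !linearD /= !mxvecK !rowK !mxE mul1r mulr1 => <-.
apply: (@traceR_product_formula_false s R xi s_gt1 R_galois xi_order s_ge3 c%:R a) => k.
have [i ->] : exists i : 'I_(2 ^ s), xi ^+ k = teich xi i.
  have : xi ^+ k \in teichmuller s xi.
    by apply/(teichmullerP s_gt1 xi_order); right; exists k.
  by case/imsetP=> i _ ->; exists i.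
have := congr1 (fun t : 'Z_4 => (t : nat)%:R : R) (coord i).
rewrite !(Z4_natrD R_galois) !(Z4_natrM R_galois) !trace_natr //.
Qed.
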